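(* Suppose the system function $\vartheta$ has Cantor's divisibility property: for all $N\in\omega_+$ there exists $m\in\omega$ such that $N$ divides $\prod_{n=1}^{m-1}\vartheta(n)$. Then a real number $[a]\in\mathcal{S}_{\mathbb{R}}$ is rational if and only if $[a]=[0]$ or $[a]$ has (i.e. contains) a secondary auxiliary function.
   Context: Conventions. $\omega=\{0,1,2,\dots\}$, $\omega_+=\omega\setminus\{0\}$, $[a,b]_\omega=\{n\in\omega:a\le n\le b\}$, $[a,\infty]_\omega=\{n\in\omega:n\ge a\}$; empty products equal $1$. A system function is a function $\vartheta:\omega_+\to[2,\infty]_\omega$; one is fixed. Contractions. For $f:\omega\to\omega$ and $n\in\omega_+$, the contraction $c_n$ is applicable to $f$ iff $f(n+1)\ge\vartheta(n)$, and then $c_n(f)(n)=f(n)+1$, $c_n(f)(n+1)=f(n+1)-\vartheta(n)$, $c_n(f)(k)=f(k)$ for other $k$. A sequence of contractions is a finite (possibly empty) composition of contractions; it is applicable to $f$ iff each contraction in turn is applicable to the result of the preceding ones. Sign. For $f:\omega\to\omega$, $\sigma(f)=0$ if $f(0)$ is odd and $\sigma(f)=1$ if $f(0)$ is even. Auxiliary functions. $h:\omega\to\omega$ is a primary auxiliary function ($h\in A_p$) if $h(k)<\vartheta(k-1)$ for all $k\ge2$ and for every $N\in\omega_+$ there is $M\ge N+1$ with $h(M)\ne\vartheta(M-1)-1$. It is a secondary auxiliary function ($h\in A_s$) if $h(k)<\vartheta(k-1)$ for all $k\ge2$ and there is $N\in\omega_+$ with $h(M)=\vartheta(M-1)-1$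 for all $M\ge N+1$; the least such $N$ is $N^h_{\min}$. Base set. $W_1$ is the set of pairs $(h_p,h_s)\in A_p\times A_s$ such that, with $N=N^{h_s}_{\min}$, $h_p(k)=h_s(k)$ for $k<N$, $h_p(N)=h_s(N)+1$, and $h_p(k)=0$ for $k>N$. Two pairs in $W_1$ are equivalent if their first components agree on $\omega_+$ and have the same sign; $F$ is the collection of sets obtained by taking, for each equivalence class, the set of all functions that are components of its pairs. $W_2$ is the set of primary auxiliary functions occurring in no pair of $W_1$; two elements of $W_2$ are equivalent if they agree on $\omega_+$ and have the same sign; $G_2$ is the set of equivalence classes. The base set is $B=F\cup G_2$. Real numbers. For $b\in B$, $r_b$ is the set of $f:\omega\to\omega$ for which there is $h\in b$ such that for every $N\in\omega_+$ some sequence of contractions $\mathcal{C}$ applicable to $f$ satisfies $\mathcal{C}(f)(n)=h(n)$ for all $n\in[0,N]_\omega$. Let $b_1,b_2\in B$ be the elements containing respectively the zero function, and the function with value $1$ at $0$ and $0$ elsewhere. $\mathcal{S}_{\mathbb{R}}$ (the set of real numbers) consists of all $r_b$ with $b\in B\setminus\{b_1,b_2\}$ together with $[0]:=r_{b_1}\cup r_{b_2}$. Distinct real numbers are disjoint. A function lying in some real number is called finite, and $[f]$ denotes the real number containing $f$. $[1]:=[1_p]$, where $1_p(1)=1$ and $1_p(k)=0$ for $k\ne1$. For a real number $[a]$, $a_p$ and $a_s$ denote a primary and (if one exists) a secondary auxiliary function contained in $[a]$; their values on $\omega_+$ are uniquely determined. $\Psi(f,g)$ denotes the least $n\in\omega_+$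 with $f(n)\ne g(n)$. Multiplication. For $a,b\in\omega$ let $\Upsilon(a,b)=\max\{a,b\}-\min\{a,b\}$. For $n,k,K\in\omega_+$ let $$R(n,k,K)=\max\Big\{t\in\omega:\ t\prod_{j=1}^{n-1}\vartheta(j)\prod_{j=1}^{k-1}\vartheta(j)\le\prod_{j=1}^{K-1}\vartheta(j)\Big\}.$$ The rest function is $r(n,k,1)=R(n,k,1)$ and $r(n,k,M)=\Upsilon\big(R(n,k,M),\ \vartheta(M-1)R(n,k,M-1)\big)$ for $M\ge2$. For finite $f,g$ the sub-product $f*g:\omega\to\omega$ is $(f*g)(0)=f(0)+g(0)$ and $(f*g)(M)=\sum_{n=1}^M\sum_{k=1}^M f(n)g(k)\,r(n,k,M)$ for $M\in\omega_+$. Multiplication of real numbers: $[f]*[g]:=[f*g]$ for any $f\in[f]$, $g\in[g]$ (independent of the choice of representatives). For $[c]\ne[0]$, $[c]^{-1}$ is the unique real number with $[c]*[c]^{-1}=[1]$. Integers and rationals. A real number $[a]$ is an integer if $[a]=[0]$, or if $[a]$ contains a secondary auxiliary function and $\Psi(a_p,a_s)=1$. A real number $[a]$ is rational if $[a]=[b]*[c]^{-1}$ for some integers $[b],[c]$ with $[c]\ne[0]$. *)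

(* Defs.v *)
From mathcomp Require Import all_boot.
From mathcomp Require Import boolp classical_sets.

Set Implicit Arguments.
Unset Strict Implicit.
Unset Printing Implicit Defensive.

Local Open Scope classical_set_scope.

(* Definite descriptions: each is used only where the described object exists
   and is unique; elsewhere it takes a junk value (0 or the empty set). *)
Definition least (P : set nat) : nat :=
  xget 0 [set n | P n /\ forall m, P m -> n <= m].

Definition greatest (P : set nat) : nat :=
  xget 0 [set n | P n /\ forall m, P m -> m <= n].

Definition the_member (C : set (set (nat -> nat))) (f : nat -> nat) :
    set (nat -> nat) :=
  xget set0 [set x | C x /\ x f].

(* A system function lives on the positive integers; it is represented by a
   total function, and no definition below depends on its value at 0. *)
Definition system_function (th : nat -> nat) : Prop :=
  forall n, 0 < n -> 2 <= th n.

Definition contract (th : nat -> nat) (f : nat -> nat) (n : nat) : nat -> nat :=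
  fun k => if k == n then f n + 1
           else if k == n.+1 then f n.+1 - th n
           else f k.

(* A sequence of contractions is the list of its indices, the head being the
   contraction performed first. *)
Definition contract_seq (th : nat -> nat) (f : nat -> nat) (s : seq nat) :
    nat -> nat :=
  foldl (contract th) f s.

Fixpoint applicable_seq (th : nat -> nat) (f : nat -> nat) (s : seq nat) : bool :=
  if s is n :: s' then
    [&& 0 < n, th n <= f n.+1 & applicable_seq th (contract th f n) s']
  else true.

Definition sign (f : nat -> nat) : nat := if odd (f 0) then 0 else 1.

Definition primary_aux (th : nat -> nat) : set (nat -> nat) :=
  [set h | (forall k, 2 <= k -> h k < th (k - 1)) /\
           (forall N, 0 < N -> exists2 M, N + 1 <= M & h M <> th (M - 1) - 1)].

Definition secondary_tail (th : nat -> nat) (h : nat -> nat) : set nat :=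
  [set N | 0 < N /\ forall M, N + 1 <= M -> h M = th (M - 1) - 1].

Definition secondary_aux (th : nat -> nat) : set (nat -> nat) :=
  [set h | (forall k, 2 <= k -> h k < th (k - 1)) /\
           (exists N, secondary_tail th h N)].

Definition Nmin (th : nat -> nat) (h : nat -> nat) : nat :=
  least (secondary_tail th h).

Definition W1 (th : nat -> nat) : set ((nat -> nat) * (nat -> nat)) :=
  [set p | [/\ primary_aux th p.1,
               secondary_aux th p.2,
               (forall k, k < Nmin th p.2 -> p.1 k = p.2 k),
               p.1 (Nmin th p.2) = p.2 (Nmin th p.2) + 1 &
               (forall k, Nmin th p.2 < k -> p.1 k = 0)]].

Definition aux_equiv (g h : nat -> nat) : Prop :=
  (forall k, 0 < k -> g k = h k) /\ sign g = sign h.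

Definition base_F (th : nat -> nat) : set (set (nat -> nat)) :=
  [set b | exists2 p, W1 th p &
     b = [set f | exists q, [/\ W1 th q, aux_equiv p.1 q.1 &
                                f = q.1 \/ f = q.2]]].

Definition W2 (th : nat -> nat) : set (nat -> nat) :=
  [set h | primary_aux th h /\
           ~ (exists2 p, W1 th p & h = p.1 \/ h = p.2)].

Definition base_G2 (th : nat -> nat) : set (set (nat -> nat)) :=
  [set b | exists2 h, W2 th h & b = [set g | W2 th g /\ aux_equiv h g]].

Definition base_set (th : nat -> nat) : set (set (nat -> nat)) :=
  base_F th `|` base_G2 th.

Definition real_of (th : nat -> nat) (b : set (nat -> nat)) : set (nat -> nat) :=
  [set f | exists2 h, b h &
     forall N, 0 < N ->
       exists2 s, applicable_seq th f s &
         forall n, n <= N -> contract_seq th f s n = h n].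

Definition b1 (th : nat -> nat) : set (nat -> nat) :=
  the_member (base_set th) (fun=> 0).

Definition b2 (th : nat -> nat) : set (nat -> nat) :=
  the_member (base_set th) (fun k => if k == 0 then 1 else 0).

Definition real_zero (th : nat -> nat) : set (nat -> nat) :=
  real_of th (b1 th) `|` real_of th (b2 th).

Definition real_numbers (th : nat -> nat) : set (set (nat -> nat)) :=
  [set x | (exists b, [/\ base_set th b, b <> b1 th, b <> b2 th &
                          x = real_of th b])
           \/ x = real_zero th].

Definition real_class (th : nat -> nat) (f : nat -> nat) : set (nat -> nat) :=
  the_member (real_numbers th) f.

Definition real_one (th : nat -> nat) : set (nat -> nat) :=
  real_class th (fun k => if k == 1 then 1 else 0).

Definition Psi (f g : nat -> nat) : nat :=
  least [set n | 0 < n /\ f n <> g n].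

Definition Upsilon (a b : nat) : nat := maxn a b - minn a b.

Definition Rmax (th : nat -> nat) (n k K : nat) : nat :=
  greatest [set t | t * (\prod_(1 <= j < n) th j) * (\prod_(1 <= j < k) th j)
                    <= \prod_(1 <= j < K) th j].

(* Only the values at positive [M] matter. *)
Definition rest (th : nat -> nat) (n k M : nat) : nat :=
  if M == 1 then Rmax th n k 1
  else Upsilon (Rmax th n k M) (th (M - 1) * Rmax th n k (M - 1)).

Definition sub_product (th : nat -> nat) (f g : nat -> nat) : nat -> nat :=
  fun M => if M == 0 then f 0 + g 0
           else \sum_(1 <= n < M.+1) \sum_(1 <= k < M.+1)
                  f n * g k * rest th n k M.

(* The real number that contains [f * g] whatever the representatives f of x
   and g of y. *)
Definition real_mul (th : nat -> nat) (x y : set (nat -> nat)) :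
    set (nat -> nat) :=
  xget set0 [set z | real_numbers th z /\
                     forall f g, x f -> y g -> z (sub_product th f g)].

Definition real_inv (th : nat -> nat) (c : set (nat -> nat)) : set (nat -> nat) :=
  xget set0 [set z | real_numbers th z /\ real_mul th c z = real_one th].

(* [ap] and [as_] are determined by [a] on the positive integers, hence so is
   [Psi ap as_]. *)
Definition real_integer (th : nat -> nat) (a : set (nat -> nat)) : Prop :=
  real_numbers th a /\
  (a = real_zero th \/
   exists ap as_, [/\ primary_aux th ap /\ a ap,
                      secondary_aux th as_ /\ a as_ &
                      Psi ap as_ = 1]).

Definition real_rational (th : nat -> nat) (a : set (nat -> nat)) : Prop :=
  real_numbers th a /\
  exists b c, [/\ real_integer th b, real_integer th c, c <> real_zero th &
                  a = real_mul th b (real_inv th c)].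

Definition cantor_divisibility (th : nat -> nat) : Prop :=
  forall N, 0 < N -> exists m, N %| \prod_(1 <= n < m) th n.

(* Main.v *)
(* A function f is read as the mixed-radix expansion with value
   sum_k f(k) / P(k), where P(k) = th(1) ... th(k-1).  A contraction at n adds
   1/P(n) to the n-th partial sum and leaves the others alone, so contracting f
   to an auxiliary function h means that the partial sums of f and h are cofinal
   in each other.  Hence a number whose value x can be written t / P(K) is the
   set of all functions of value x and the right sign: those whose partial sums
   reach x contract to the primary expansion, the others to the secondary one.
   Carries in the sub-product telescope, so values multiply.  Under Cantor's
   property every nonnegative rational is some t / P(K); for x > 0 its class
   contains a secondary function, and a secondary function has such a value. *)

Require Import Defs.
From mathcomp Require Import all_boot.
From mathcomp Require Import boolp classical_sets.
From mathcomp Require Import all_order all_algebra.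
From mathcomp Require Import zify lra.

Set Implicit Arguments.
Unset Strict Implicit.
Unset Printing Implicit Defensive.

Import Order.TTheory GRing.Theory Num.Theory.

(** * Partial sums and contractions *)

Section Numeration.
Local Open Scope ring_scope.
Variables (th : nat -> nat) (hth : system_function th).

Definition place (k : nat) : nat := (\prod_(1 <= j < k) th j)%N.

Definition psum (f : nat -> nat) (M : nat) : rat :=
  \sum_(1 <= k < M.+1) (f k)%:R / (place k)%:R.

(** The supremum of the partial sums, phrased inside [rat]; a function with irrational supremum has
    no value in this sense. *)
Definition has_value (f : nat -> nat) (x : rat) : Prop :=
  (forall M, psum f M <= x) /\ (forall y, y < x -> exists M, y < psum f M).

(** Position 1 carries the integer part, so its digit stays unbounded. *)
Definition reduced_upto (M : nat) (f : nat -> nat) : Prop :=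
  forall k, (2 <= k <= M)%N -> (f k < th (k - 1))%N.

Definition reduced (f : nat -> nat) : Prop :=
  forall k, (2 <= k)%N -> (f k < th (k - 1))%N.

Lemma th_ge2 n : (0 < n)%N -> (2 <= th n)%N.
Proof. exact: hth. Qed.

Lemma place1 : place 1 = 1%N.
Proof. by rewrite /place big_geq. Qed.

Lemma placeS k : (0 < k)%N -> place k.+1 = (th k * place k)%N.
Proof. by move=> k0; rewrite /place big_nat_recr //= mulnC. Qed.

Lemma place_gt0 k : (0 < place k)%N.
Proof.
rewrite /place big_nat_cond; apply: prodn_cond_gt0 => i /andP[/andP[i0 _] _].
by rewrite (leq_trans _ (th_ge2 i0)).
Qed.

Lemma placeR_gt0 k : 0 < (place k)%:R :> rat.
Proof. by rewrite ltr0n place_gt0. Qed.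

Lemma placeR_neq0 k : (place k)%:R != 0 :> rat.
Proof. by rewrite gt_eqF // placeR_gt0. Qed.

Lemma place_lt i j : (0 < i)%N -> (i < j)%N -> (place i < place j)%N.
Proof.
move=> i0; elim: j => // j IH; rewrite ltnS leq_eqVlt => /orP[/eqP<-|ij].
  by rewrite placeS // -[ltnLHS]mul1n ltn_pmul2r ?place_gt0 ?th_ge2.
have j0 : (0 < j)%N by exact: leq_trans ij.
apply: (leq_trans (IH ij)); rewrite placeS // leq_pmull //.
by rewrite (leq_trans _ (th_ge2 j0)).
Qed.

Lemma place_dvd i j : (0 < i)%N -> (i <= j)%N -> (place i %| place j)%N.
Proof.
by move=> i0 ij; rewrite /place (big_cat_nat i0 ij) // dvdn_mulr.
Qed.

Lemma leq_place k : (k <= place k)%N.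
Proof.
elim: k => // -[_|k IH]; first by rewrite place1.
by rewrite (leq_ltn_trans IH) // place_lt.
Qed.

Lemma inv_placeS k : (0 < k)%N ->
  (place k)%:R^-1 = (th k)%:R / (place k.+1)%:R :> rat.
Proof.
move=> k0; rewrite placeS // natrM invfM mulrA mulfV ?mul1r //.
by rewrite pnatr_eq0 -lt0n (leq_trans _ (th_ge2 k0)).
Qed.

Lemma inv_place_small (y : rat) : 0 < y ->
  exists N, forall M, (N <= M)%N -> (place M)%:R^-1 < y.
Proof.
move=> y0; exists (Num.truncn y^-1).+1 => M NM.
rewrite -[ltRHS]invrK ltf_pV2 ?posrE ?invr_gt0 ?placeR_gt0 //.
apply: (lt_le_trans (truncnS_gt _)); rewrite ler_nat.
exact: leq_trans NM (leq_place M).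
Qed.

Lemma psum0 f : psum f 0 = 0.
Proof. by rewrite /psum big_geq. Qed.

Lemma psumS f M : psum f M.+1 = psum f M + (f M.+1)%:R / (place M.+1)%:R.
Proof. by rewrite /psum big_nat_recr. Qed.

Lemma psum1 f : psum f 1 = (f 1%N)%:R.
Proof. by rewrite psumS psum0 place1 divr1 add0r. Qed.

Lemma psum_term_ge0 (f : nat -> nat) k : 0 <= (f k)%:R / (place k)%:R :> rat.
Proof. by rewrite divr_ge0 ?ler0n. Qed.

Lemma psum_le f i j : (i <= j)%N -> psum f i <= psum f j.
Proof.
elim: j => [|j IH]; first by rewrite leqn0 => /eqP->.
rewrite leq_eqVlt => /orP[/eqP->//|/IH h].
by rewrite psumS (le_trans h) // lerDl psum_term_ge0.
Qed.

Lemma psum_ge0 f M : 0 <= psum f M.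
Proof. by rewrite -(psum0 f) psum_le. Qed.

Lemma eq_psum f g M : (forall k, (0 < k <= M)%N -> f k = g k) ->
  psum f M = psum g M.
Proof. by move=> fg; apply: eq_big_nat => k hk; rewrite fg. Qed.

Lemma psum_const f N M : (N <= M)%N -> (forall k, (N < k)%N -> f k = 0%N) ->
  psum f M = psum f N.
Proof.
move=> + f0; elim: M => [|M IH]; first by rewrite leqn0 => /eqP->.
rewrite leq_eqVlt => /orP[/eqP->//|NM].
by rewrite psumS f0 // mul0r addr0 IH.
Qed.

Lemma psum_integral f M : (0 < M)%N ->
  exists t : nat, psum f M = t%:R / (place M)%:R.
Proof.
case: M => // M _; elim: M => [|M [t IH]].
  by exists (f 1%N); rewrite psum1 place1 divr1.
exists (t * th M.+1 + f M.+2)%N.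
by rewrite psumS IH inv_placeS // natrD natrM mulrDl -mulrA.
Qed.

(** A digit at [M.+1] is at most [th M - 1], and together with one more unit at that position it is
    worth at most one unit at [M]. So the intervals from a partial sum to one unit above it are
    nested. *)
Lemma reduced_psum_anti N M f : (0 < N)%N -> (N <= M)%N -> reduced_upto M f ->
  psum f M + (place M)%:R^-1 <= psum f N + (place N)%:R^-1.
Proof.
move=> N0; elim: M => [|M IH]; first by rewrite leqn0 => /eqP->.
rewrite leq_eqVlt => /orP[/eqP->//|NM rf].
have M0 : (0 < M)%N by exact: leq_trans N0 NM.
apply: le_trans (IH NM _); last first.
  by move=> k /andP[k2 kM]; apply: rf; rewrite k2 ltnW.
rewrite psumS (inv_placeS M0) -addrA lerD2l -{2}[(place M.+1)%:R^-1]mul1r.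
rewrite -mulrDl ler_pM2r ?invr_gt0 ?placeR_gt0 // natr1 ler_nat.
by have := rf M.+1; rewrite subn1 ltnS leqnn andbT => /(_ M0).
Qed.

Lemma reducedW M f : reduced f -> reduced_upto M f.
Proof. by move=> rf k /andP[k2 _]; exact: rf. Qed.

Lemma reduced_psum_lt N M f : (0 < N)%N -> reduced_upto M f ->
  psum f M < psum f N + (place N)%:R^-1.
Proof.
move=> N0 rf; have [NM|MN] := leqP N M.
  apply: lt_le_trans (reduced_psum_anti N0 NM rf).
  by rewrite ltrDl invr_gt0 placeR_gt0.
apply: (le_lt_trans (psum_le f (ltnW MN))).
by rewrite ltrDl invr_gt0 placeR_gt0.
Qed.

(** Both sums are integral multiples of the unit at [N]. *)
Lemma psum_grid f g N : (0 < N)%N -> psum f N < psum g N ->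
  psum f N + (place N)%:R^-1 <= psum g N.
Proof.
move=> N0; have [t ->] := psum_integral f N0; have [u ->] := psum_integral g N0.
rewrite -[X in _ + X]mul1r -mulrDl natr1.
by rewrite ltr_pM2r ?ler_pM2r ?invr_gt0 ?placeR_gt0 // ltr_nat ler_nat.
Qed.

Lemma psum_inj f g N : (forall n, (n <= N)%N -> psum f n = psum g n) ->
  forall n, (0 < n <= N)%N -> f n = g n.
Proof.
move=> fg [//|n] /andP[_ nN].
have := fg _ nN; rewrite !psumS (fg n (ltnW nN)) => /addrI /(mulIf _) h.
by apply/eqP; rewrite -(@eqr_nat rat); apply/eqP/h; rewrite invr_eq0 placeR_neq0.
Qed.

(** * Contractions and their effect on partial sums *)

Lemma contract0 f n : (0 < n)%N -> contract th f n 0 = f 0%N.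
Proof. by case: n. Qed.

(** The [th n] units removed at [n.+1] are worth exactly the unit added at [n], so only the sum cut
    between these two positions changes. *)
Lemma psum_contract f n M : (0 < n)%N -> (th n <= f n.+1)%N ->
  psum (contract th f n) M =
  psum f M + (if M == n then (place n)%:R^-1 else 0).
Proof.
move=> n0 hn; have below m : (m < n)%N -> psum (contract th f n) m = psum f m.
  move=> mn; apply: eq_psum => k /andP[_ km]; rewrite /contract.
  by do 2 (case: eqP => [?|_]; first lia).
have at_n : psum (contract th f n) n = psum f n + (place n)%:R^-1.
  case: n n0 hn below {M} => // n _ hn below.
  by rewrite !psumS below // {1}/contract eqxx addn1 -natr1 mulrDl mul1r addrA.
have [Mn|nM|->] := ltngtP M n; last by rewrite at_n.
  by rewrite below // addr0.
rewrite addr0; elim: M nM => // M IH; rewrite ltnS leq_eqVlt => /orP[/eqP nM|nM].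
  rewrite -nM !psumS at_n /contract gtn_eqF // eqxx natrB // inv_placeS // -addrA.
  by rewrite -mulrDl subrKC.
rewrite !psumS IH // /contract.
by do 2 (case: eqP => [?|_]; first lia).
Qed.

Lemma contract_seq0 f s : applicable_seq th f s -> contract_seq th f s 0 = f 0%N.
Proof.
elim: s f => //= n s IH f /and3P[n0 _ /IH h].
by rewrite -[RHS](contract0 f n0) -h.
Qed.

Lemma psum_contract_seq_ge f s M : applicable_seq th f s ->
  psum f M <= psum (contract_seq th f s) M.
Proof.
elim: s f => //= n s IH f /and3P[n0 hn /IH h].
apply: le_trans h; rewrite psum_contract // lerDl.
by case: eqP => // _; rewrite invr_ge0.
Qed.

Lemma psum_contract_seq_eq f s M : applicable_seq th f s -> all (ltn^~ M) s ->
  psum (contract_seq th f s) M = psum f M.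
Proof.
elim: s f => //= n s IH f /and3P[n0 hn happ] /andP[nM hs].
have := IH _ happ hs; rewrite /contract_seq /= => ->.
by rewrite psum_contract // gtn_eqF // addr0.
Qed.

Lemma contract_seq_fix f s M k : all (ltn^~ M) s -> (M < k)%N ->
  contract_seq th f s k = f k.
Proof.
elim: s f => //= n s IH f /andP[nM hs] Mk.
have := IH (contract th f n) hs Mk; rewrite /contract_seq /= => ->.
rewrite /contract.
by do 2 (case: eqP => [?|_]; first lia).
Qed.

(* Each contraction lowers the digit sum, because [th n >= 2]. *)
Lemma normalize M f : exists s,
  [/\ applicable_seq th f s, all (ltn^~ M) s & reduced_upto M (contract_seq th f s)].
Proof.
have [m] := ubnP (\sum_(0 <= k < M.+1) f k)%N.
elim: m f => // m IH f hm.
have [rf|] := pselect (reduced_upto M f); first by exists [::].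
move=> /existsNP[k /not_implyP[]]; case: k => // n /andP[n1 nM] /negP.
rewrite subn1 /= -leqNgt => hn; have n0 : (0 < n)%N by [].
have [|s [happ hs rs]] := IH (contract th f n); last first.
  by exists (n :: s); split=> //=; rewrite ?n0 ?hn ?nM.
have split_sum (g : nat -> nat) : (\sum_(0 <= k < M.+1) g k =
    \sum_(0 <= k < n) g k + (g n + g n.+1) + \sum_(n.+2 <= k < M.+1) g k)%N.
  rewrite (@big_cat_nat _ _ _ n) //=; last lia.
  rewrite (@big_cat_nat _ _ _ n.+2 n) //=; last lia.
  by rewrite (big_ltn (ltnW (ltnSn _))) big_nat1 addnA.
rewrite ltnS in hm; apply: leq_trans hm; rewrite !split_sum.
have -> : (\sum_(0 <= k < n) contract th f n k = \sum_(0 <= k < n) f k)%N.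
  apply: eq_big_nat => k hk; rewrite /contract.
  by do 2 (case: eqP => [?|_]; first lia).
have -> : (\sum_(n.+2 <= k < M.+1) contract th f n k
           = \sum_(n.+2 <= k < M.+1) f k)%N.
  apply: eq_big_nat => k hk; rewrite /contract.
  by do 2 (case: eqP => [?|_]; first lia).
rewrite ltn_add2r ltn_add2l /contract eqxx gtn_eqF // eqxx.
have := th_ge2 n0; lia.
Qed.

(** At each level [n] the point [psum g M] lies in the half-open grid cell starting at [psum g n]
    and in the one starting at [psum h n]. Cells of one grid sharing a point coincide, so all
    partial sums up to [N] agree, and with them the digits. *)
Lemma psum_squeeze N M g h : (N <= M)%N -> reduced_upto M g -> reduced h ->
  psum h N <= psum g M < psum h N + (place N)%:R^-1 ->
  forall n, (0 < n <= N)%N -> g n = h n.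
Proof.
move=> NM rg rh /andP[lo hi]; apply: psum_inj => -[|n] nN; first by rewrite !psum0.
have lo' : psum h n.+1 <= psum g M by rewrite (le_trans (psum_le h nN)).
have hi' : psum g M < psum h n.+1 + (place n.+1)%:R^-1.
  by rewrite (lt_le_trans hi) // reduced_psum_anti //; exact: reducedW.
have gh := reduced_psum_lt (isT : 0 < n.+1)%N rg.
have gn := psum_le g (leq_trans nN NM).
have [lt|lt|//] := ltgtP (psum g n.+1) (psum h n.+1).
  have := psum_grid (isT : 0 < n.+1)%N lt; lra.
have := psum_grid (isT : 0 < n.+1)%N lt; lra.
Qed.

(** The condition in [real_of], isolated for a single target [h]. *)
Definition contracts_to (f h : nat -> nat) : Prop :=
  forall N, (0 < N)%N -> exists2 s, applicable_seq th f s &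
    forall n, (n <= N)%N -> contract_seq th f s n = h n.

Lemma contracts_to_refl f : contracts_to f f.
Proof. by move=> N _; exists [::]. Qed.

Lemma contracts_toI f h : reduced h -> f 0%N = h 0%N ->
  (forall N, (0 < N)%N -> exists2 M, (N <= M)%N &
     psum h N <= psum f M < psum h N + (place N)%:R^-1) ->
  contracts_to f h.
Proof.
move=> rh fh0 H N N0; have [M NM hM] := H N N0.
have [s [happ hs rs]] := normalize M f.
exists s => // -[_|n nN]; first by rewrite contract_seq0.
by apply: (psum_squeeze NM rs rh) => //; rewrite psum_contract_seq_eq.
Qed.

Lemma contracts_to0 f h : contracts_to f h -> f 0%N = h 0%N.
Proof. by move=> /(_ 1%N isT)[s happ <-//]; rewrite contract_seq0. Qed.

Lemma contracts_to_le f h N : contracts_to f h -> psum f N <= psum h N.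
Proof.
case: N => [|N]; first by rewrite !psum0.
move=> /(_ N.+1 isT)[s happ e]; rewrite (le_trans (psum_contract_seq_ge _ happ)) //.
by rewrite le_eqVlt; apply/orP/or_introl/eqP/eq_psum => k /andP[_ /e].
Qed.

Lemma contracts_to_ge f h N : contracts_to f h ->
  exists M, psum h N <= psum f M.
Proof.
case: N => [|N]; first by exists 0%N; rewrite !psum0.
(* A cut beyond every index of [s] gives a partial sum that the whole sequence leaves unchanged. *)
move=> /(_ N.+1 isT)[s happ e]; exists (maxn N.+1 (\max_(n <- s) n).+1).
rewrite -(psum_contract_seq_eq happ) //; last first.
  apply/allP => n ns /=; rewrite leq_max ltnS; apply/orP; right.
  exact: leq_bigmax_seq.
rewrite (le_trans _ (psum_le _ (leq_maxl _ _))) //.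
rewrite le_eqVlt; apply/orP/or_introl/eqP/eq_psum => k /andP[_ kN].
by rewrite e.
Qed.

Lemma has_value_contracts f h x : contracts_to f h -> has_value h x <-> has_value f x.
Proof.
move=> c; split=> -[ub ap]; split.
- by move=> M; rewrite (le_trans _ (ub M)) // contracts_to_le.
- move=> y /ap[M yM]; have [M' hM'] := contracts_to_ge M c.
  by exists M'; rewrite (lt_le_trans yM).
- by move=> M; have [M' hM'] := contracts_to_ge M c; rewrite (le_trans hM').
- by move=> y /ap[M yM]; exists M; rewrite (lt_le_trans yM) // contracts_to_le.
Qed.

(** An excess of [h'] over [h] at level [n] would be at least one unit there. But [f] dominates the
    partial sums of [h'] and is dominated by [h], whose later sums never gain a full unit. *)
Lemma contracts_to_psum_le f h h' : reduced h -> contracts_to f h ->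
  contracts_to f h' -> forall n, psum h' n <= psum h n.
Proof.
move=> rh c c' [|n]; first by rewrite !psum0.
rewrite leNgt; apply/negP => lt.
have [M hM] := contracts_to_ge n.+1 c'.
have := contracts_to_le M c; have := reduced_psum_lt (isT : 0 < n.+1)%N (@reducedW M _ rh).
have := psum_grid (isT : 0 < n.+1)%N lt; lra.
Qed.

Lemma contracts_to_inj f h h' : reduced h -> reduced h' ->
  contracts_to f h -> contracts_to f h' -> h = h'.
Proof.
move=> rh rh' c c'; apply/funext => -[|n].
  by rewrite -(contracts_to0 c) -(contracts_to0 c').
apply: (@psum_inj _ _ n.+1) => [m _|]; last by rewrite leqnn.
apply/eqP; rewrite eq_le.
by rewrite (contracts_to_psum_le rh' c' c) (contracts_to_psum_le rh c c').
Qed.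

(** * Values of expansions *)

Lemma has_value_uniq f x y : has_value f x -> has_value f y -> x = y.
Proof.
move=> [ub ap] [ub' ap'].
have [/ap'[M]|/ap[M]|//] := ltgtP x y; first by rewrite ltNge ub.
by rewrite ltNge ub'.
Qed.

Lemma eq_has_value f g x : (forall k, (0 < k)%N -> f k = g k) ->
  has_value f x -> has_value g x.
Proof.
move=> fg; have e M : psum g M = psum f M by apply: eq_psum => k /andP[/fg->].
by move=> [ub ap]; split=> [M|y /ap[M yM]]; [rewrite e|exists M; rewrite e].
Qed.

Lemma has_value_ge0 f x : has_value f x -> 0 <= x.
Proof. by move=> [/(_ 0%N)]; rewrite psum0. Qed.

Lemma has_value0P f : has_value f 0 <-> forall k, (0 < k)%N -> f k = 0%N.
Proof.
split=> [[ub _] [//|k _]|f0].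
  have : (f k.+1)%:R / (place k.+1)%:R = 0 :> rat.
    have := ub k.+1; rewrite psumS.
    by have := psum_ge0 f k; have := psum_term_ge0 f k.+1; lra.
  move=> /eqP; rewrite mulf_eq0 invr_eq0 (negbTE (placeR_neq0 _)) orbF.
  by rewrite pnatr_eq0 => /eqP.
have z M : psum f M = 0 by rewrite (@psum_const f 0) // ?psum0 // => k /f0.
by split=> [M|y y0]; [rewrite z|exists 0%N; rewrite z].
Qed.

Lemma has_value_finite f N : (forall k, (N < k)%N -> f k = 0%N) ->
  has_value f (psum f N).
Proof.
move=> f0; split=> [M|y yx]; last by exists N.
have [NM|/ltnW MN] := leqP N M; last exact: psum_le.
by rewrite (@psum_const f N).
Qed.

(** A maximal digit [th M - 1] at [M.+1] is worth the unit at [M] minus the unit at [M.+1], so the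
    tail telescopes. *)
Lemma psum_secondary h N M : (0 < N)%N -> (N <= M)%N ->
  secondary_tail th h N ->
  psum h M = psum h N + (place N)%:R^-1 - (place M)%:R^-1.
Proof.
move=> N0 + [_ ht]; elim: M => [|M IH]; first by rewrite leqn0; case: N N0 {ht}.
rewrite leq_eqVlt => /orP[/eqP->|NM]; first by rewrite addrK.
have M0 : (0 < M)%N by exact: leq_trans N0 NM.
rewrite psumS IH // ht; last by rewrite addn1.
rewrite subSS subn0 natrB ?(leq_trans _ (th_ge2 M0)) // mulrBl mul1r -inv_placeS //.
by rewrite addrA subrK.
Qed.

Lemma has_value_secondary h N : secondary_tail th h N ->
  has_value h (psum h N + (place N)%:R^-1).
Proof.
move=> ht; have N0 := ht.1; split=> [M|y yx].
  have [NM|/ltnW MN] := leqP N M.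
    by rewrite (psum_secondary N0 NM ht) gerBl invr_ge0.
  by rewrite (le_trans (psum_le h MN)) // lerDl invr_ge0.
have [K hK] := inv_place_small (etrans (subr_gt0 _ _) yx).
exists (maxn N K); rewrite (psum_secondary N0 (leq_maxl _ _) ht).
have := hK _ (leq_maxr N K); lra.
Qed.


(** * Sub-products *)

Lemma greatestP (P : set nat) n : P n -> (forall m, P m -> (m <= n)%N) ->
  greatest P = n.
Proof.
move=> Pn ub; apply: xget_unique => [|m [Pm ubm]]; first by split.
by apply/eqP; rewrite eqn_leq ub // ubm.
Qed.

Lemma leastP (P : set nat) n : P n -> (forall m, P m -> (n <= m)%N) ->
  least P = n.
Proof.
move=> Pn lb; apply: xget_unique => [|m [Pm lbm]]; first by split.
by apply/eqP; rewrite eqn_leq lb // lbm.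
Qed.

Lemma Rmax_div n k M : Rmax th n k M = (place M %/ (place n * place k))%N.
Proof.
have h0 : (0 < place n * place k)%N by rewrite muln_gt0 !place_gt0.
apply: greatestP => [|t] /=; rewrite -mulnA -/(place n) -/(place k) -/(place M).
  by rewrite -leq_divRL.
by rewrite leq_divRL.
Qed.

Lemma Rmax_lt n k M : (0 < n)%N -> (0 < k)%N -> (0 < M)%N ->
  (M < n)%N || (M < k)%N -> Rmax th n k M = 0%N.
Proof.
move=> n0 k0 M0 Mnk; rewrite Rmax_div divn_small //.
case/orP: Mnk => h; have := place_lt M0 h => /leq_trans; apply.
  by rewrite leq_pmulr ?place_gt0.
by rewrite leq_pmull ?place_gt0.
Qed.

(** Multiplying a floor by [th M] never exceeds the floor at the next level, so [Upsilon] is an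
    ordinary difference: the rest is the digit at [M.+1] of the expansion of the reciprocal of
    [place n * place k]. *)
Lemma restS n k M : (0 < M)%N ->
  (th M * Rmax th n k M + rest th n k M.+1 = Rmax th n k M.+1)%N.
Proof.
move=> M0; rewrite /rest eqSS gtn_eqF // subSS subn0.
have le : (th M * Rmax th n k M <= Rmax th n k M.+1)%N.
  by rewrite !Rmax_div placeS // leq_divRL ?muln_gt0 ?place_gt0 // -mulnA
             leq_mul2l leq_divM orbT.
by rewrite /Upsilon (maxn_idPl le) (minn_idPr le) subnKC.
Qed.

(** By [restS] the digits of each pair [(n, k)] add up to one floor, so only the product of the two
    units, rounded down to the grid at [M], remains. *)
Lemma psum_sub_product f g M :
  psum (sub_product th f g) M =
  (\sum_(1 <= n < M.+1) \sum_(1 <= k < M.+1) f n * g k * Rmax th n k M)%:R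
    / (place M)%:R.
Proof.
case: M => [|M]; first by rewrite psum0 big_geq // mul0r.
elim: M => [|M IH]; first by rewrite psum1 place1 divr1.
rewrite psumS IH inv_placeS // mulrA -mulrDl -natrM -natrD; congr (_%:R / _).
rewrite {1}/sub_product [M.+2 == 0%N]/= mulnC.
(* Enlarging the range adds only pairs with an index above [M.+1], whose floor at level [M.+1] is
   0. *)
have -> : (\sum_(1 <= n < M.+2) \sum_(1 <= k < M.+2) f n * g k * Rmax th n k M.+1 =
    \sum_(1 <= n < M.+3) \sum_(1 <= k < M.+3) f n * g k * Rmax th n k M.+1)%N.
  rewrite [RHS]big_nat_recr //= [X in (_ + X)%N]big_nat_cond.
  rewrite [X in (_ + X)%N]big1 ?addn0; last first.
    by move=> k /andP[/andP[k0 _] _]; rewrite Rmax_lt ?ltnSn ?muln0.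
  apply: eq_big_nat => n /andP[n0 _]; rewrite [RHS]big_nat_recr //=.
  by rewrite (@Rmax_lt n) ?ltnSn ?orbT // muln0 addn0.
rewrite big_distrr -big_split; apply: eq_bigr => n _.
rewrite big_distrr -big_split; apply: eq_bigr => k _ /=.
by rewrite -(@restS n k M.+1) // mulnDr mulnCA.
Qed.

Lemma psum_sub_product_le f g M :
  psum (sub_product th f g) M <= psum f M * psum g M.
Proof.
rewrite psum_sub_product big_distrlr natr_sum mulr_suml; apply: ler_sum => n _.
rewrite natr_sum mulr_suml; apply: ler_sum => k _ /=.
rewrite mulrACA -invfM -!natrM [in leLHS]natrM -mulrA ler_wpM2l //.
rewrite ler_pdivrMr ?placeR_gt0 // ler_pdivlMl ?ltr0n ?muln_gt0 ?place_gt0 //.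
by rewrite -natrM ler_nat Rmax_div mulnC leq_divM.
Qed.

(** Each floor loses less than 1. With [L] fixed the total loss is a constant times the unit at [M],
    which vanishes as [M] grows. *)
Lemma psum_sub_product_ge f g L M : (L <= M)%N ->
  psum f L * psum g L -
    (\sum_(1 <= n < L.+1) \sum_(1 <= k < L.+1) f n * g k)%:R / (place M)%:R
  <= psum (sub_product th f g) M.
Proof.
move=> LM; rewrite psum_sub_product lerBlDr -mulrDl -natrD big_distrlr.
apply: (@le_trans _ _ ((\sum_(1 <= n < L.+1) \sum_(1 <= k < L.+1)
    f n * g k * (Rmax th n k M).+1)%:R / (place M)%:R)).
  rewrite natr_sum mulr_suml; apply: ler_sum => n _.
  rewrite natr_sum mulr_suml; apply: ler_sum => k _ /=.
  rewrite mulrACA -invfM -!natrM [in leRHS]natrM -mulrA ler_wpM2l //.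
  rewrite ler_pdivlMr ?placeR_gt0 // ler_pdivrMl ?ltr0n ?muln_gt0 ?place_gt0 //.
  by rewrite -natrM ler_nat Rmax_div mulnC ltnW // ltn_ceil // muln_gt0 !place_gt0.
rewrite ler_pM2r ?invr_gt0 ?placeR_gt0 // ler_nat.
under eq_bigr do under eq_bigr do rewrite mulnS.
under eq_bigr do rewrite big_split; rewrite big_split /= addnC leq_add2r.
rewrite [leqRHS](@big_cat_nat _ _ _ L.+1) //= (leq_trans _ (leq_addr _ _)) //.
apply: leq_sum => n _.
by rewrite [leqRHS](@big_cat_nat _ _ _ L.+1) //= leq_addr.
Qed.

Lemma psum_product_gt f g x y z : has_value f x -> has_value g y -> z < x * y ->
  exists L, z < psum f L * psum g L.
Proof.
move=> fx gy zxy; have [z0|z0] := ltP z 0; first by exists 0%N; rewrite !psum0 mulr0.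
have xy0 := le_lt_trans z0 zxy.
have x0 := has_value_ge0 fx; have y0 := has_value_ge0 gy.
have {}y0 : 0 < y.
  by rewrite lt_neqAle y0 andbT; apply: contraTneq xy0 => <-; rewrite mulr0 ltxx.
(* First a sum of [f] above [z / y], then a sum of [g] above [z] divided by that sum. *)
have [L hL] := fx.2 _ (etrans (ltr_pdivrMr _ _ y0) zxy).
have f0 : 0 < psum f L by rewrite (le_lt_trans _ hL) // divr_ge0 // ltW.
rewrite ltr_pdivrMr // mulrC -ltr_pdivrMr // in hL.
have [K hK] := gy.2 _ hL; rewrite ltr_pdivrMr // mulrC in hK.
exists (maxn L K); apply: (lt_le_trans hK).
by rewrite ler_pM ?psum_ge0 ?psum_le ?leq_maxl ?leq_maxr.
Qed.

Lemma has_value_sub_product f g x y : has_value f x -> has_value g y ->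
  has_value (sub_product th f g) (x * y).
Proof.
move=> fx gy; split=> [M|z zxy].
  rewrite (le_trans (psum_sub_product_le _ _ _)) //.
  by rewrite ler_pM ?psum_ge0 // ?fx.1 // gy.1.
have [L hL] := psum_product_gt fx gy zxy.
set C := (\sum_(1 <= n < L.+1) \sum_(1 <= k < L.+1) f n * g k)%N.
(* The summand 1 keeps the divisor positive when [C] is 0. *)
have C0 : 0 < C%:R + 1 :> rat by rewrite ltr_wpDl.
have d0 : 0 < (psum f L * psum g L - z) / (C%:R + 1).
  by rewrite divr_gt0 // subr_gt0.
have [N hN] := inv_place_small d0; exists (maxn L N).
apply: lt_le_trans (psum_sub_product_ge f g (leq_maxl L N)); rewrite -/C.
have := hN _ (leq_maxr L N); rewrite ltr_pdivlMr // mulrDr mulr1 mulrC.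
have : 0 <= (place (maxn L N))%:R^-1 :> rat by rewrite invr_ge0.
lra.
Qed.

(** Since [place k] divides [place M], no rounding occurs when one factor sits at position 1. The
    formula is exact for every [g], even one without a rational value. *)
Lemma psum_sub_product_nat m f g M : f 1%N = m ->
  (forall k, (1 < k)%N -> f k = 0%N) ->
  psum (sub_product th f g) M = m%:R * psum g M.
Proof.
move=> f1 f0; case: M => [|M]; first by rewrite !psum0 mulr0.
rewrite psum_sub_product big_ltn // [X in (_ + X)%N]big_nat.
rewrite [X in (_ + X)%N]big1 ?addn0; last first.
  by move=> n /andP[n1 _]; rewrite big1 // => k _; rewrite f0.
rewrite natr_sum mulr_suml /psum big_distrr; apply: eq_big_nat => k /andP[k0 kM].
rewrite f1 Rmax_div place1 mul1n !natrM -!mulrA; do 2 congr (_ * _).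
by rewrite natf_div ?place_dvd // mulrAC mulfV ?mul1r // placeR_neq0.
Qed.

(** * Auxiliary functions and the base set *)

Lemma least_mem (P : set nat) n : P n -> P (least P).
Proof.
move=> Pn; have ex : exists n, `[< P n >] by exists n; apply/asboolP.
case: (ex_minnP ex) => m /asboolP Pm lb.
by rewrite (leastP Pm) // => k Pk; apply/lb/asboolP.
Qed.

Lemma the_memberE (C : set (set (nat -> nat))) f x :
  (forall y, C y -> y f -> y = x) -> C x -> x f -> the_member C f = x.
Proof. by move=> u Cx xf; apply: xget_unique => [|y [Cy yf]]; [split|exact: u]. Qed.

Lemma primary_not_secondary h : primary_aux th h -> secondary_aux th h -> False.
Proof.
move=> [_ hp] [_ [N [N0 hN]]]; have [M NM] := hp N N0; apply; exact: hN.
Qed.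

(** Some digit beyond [N] is not maximal. There the upper ends of the nested intervals drop
    strictly, which turns the bound of [reduced_value_le] into a strict one. *)
Lemma primary_aux_value_lt h x N : primary_aux th h -> has_value h x ->
  (0 < N)%N -> x < psum h N + (place N)%:R^-1.
Proof.
move=> [rh hp] [_ ap] N0; have [M] := hp N N0.
case: M => [|M]; rewrite addn1 // ltnS subSS subn0 => NM hM.
have M0 : (0 < M)%N by exact: leq_trans NM.
apply: lt_le_trans (reduced_psum_anti N0 NM (reducedW rh)).
rewrite ltNge; apply/negP => /(lt_le_trans _) le.
have [|K hK] := ap (psum h M.+1 + (place M.+1)%:R^-1).
  apply: le; rewrite psumS (inv_placeS M0) -addrA ltrD2l.
  rewrite -{2}[(place M.+1)%:R^-1]mul1r -mulrDl ltr_pM2r ?invr_gt0 ?placeR_gt0 //.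
  rewrite natr1 ltr_nat; have := rh M.+1 M0; rewrite subSS subn0.
  have := th_ge2 M0; lia.
have := reduced_psum_lt (isT : 0 < M.+1)%N (@reducedW K _ rh).
by rewrite ltNge ltW.
Qed.

Lemma reduced_value_le h x N : reduced h -> has_value h x ->
  (0 < N)%N -> x <= psum h N + (place N)%:R^-1.
Proof.
move=> rh [_ ap] N0; rewrite leNgt; apply/negP => /ap[K].
by apply/negP; rewrite -leNgt ltW // reduced_psum_lt //; exact: reducedW.
Qed.

(** The gap to the value is one unit at every late level, so the supremum is never attained. *)
Lemma secondary_aux_value_gt h x N : secondary_aux th h -> has_value h x ->
  psum h N < x.
Proof.
move=> [_ [K hK]] hx; have K0 := hK.1.
rewrite -(has_value_uniq (has_value_secondary hK) hx).
rewrite (le_lt_trans (psum_le h (leq_maxr K N))) //.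
by rewrite (psum_secondary K0 (leq_maxl K N) hK) gtrBl invr_gt0 placeR_gt0.
Qed.

Lemma secondary_tail_Nmin h : secondary_aux th h -> secondary_tail th h (Nmin th h).
Proof. by move=> [_ [N hN]]; exact: least_mem hN. Qed.

(** The maximal tail of the secondary component is worth one unit at [N], which is exactly the
    increment of the primary digit there. *)
Lemma W1_has_value q : W1 th q ->
  exists2 x, 0 < x & has_value q.1 x /\ has_value q.2 x.
Proof.
move=> [_ /secondary_tail_Nmin]; move: (Nmin th q.2) => N hN lo at_N hi.
exists (psum q.2 N + (place N)%:R^-1).
  by rewrite ltr_wpDl ?psum_ge0 // invr_gt0 placeR_gt0.
split; last exact: has_value_secondary.
suff <- : psum q.1 N = psum q.2 N + (place N)%:R^-1 by exact: has_value_finite.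
case: N hN lo at_N {hi} => [[]//|N] _ lo at_N.
rewrite !psumS at_N natrD mulrDl mul1r addrA; congr (_ + _ + _).
by apply: eq_psum => k /andP[_ kN]; exact: lo.
Qed.

Lemma W1_fst0 q : W1 th q -> q.1 0%N = q.2 0%N.
Proof. by move=> [_ /secondary_tail_Nmin[N0 _] lo _ _]; exact: lo. Qed.

(** Contractions preserve the value at 0, while base elements record only its parity. Resetting that
    value selects the member to which a given function can contract. *)
Definition with0 (n : nat) (f : nat -> nat) : nat -> nat :=
  fun k => if k == 0%N then n else f k.

Lemma W1_with0 n q : W1 th q -> W1 th (with0 n q.1, with0 n q.2).
Proof.
move=> [[rp hp] hs lo at_N hi]; have [N0 _] := secondary_tail_Nmin hs.
have tailE : secondary_tail th (with0 n q.2) = secondary_tail th q.2.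
  apply/seteqP; split=> N [hN0 hN]; split=> // M NM; have := hN _ NM;
  by rewrite /with0; case: M NM => //; rewrite addn1.
have NE : Nmin th (with0 n q.2) = Nmin th q.2 by rewrite /Nmin tailE.
split=> /=.
- split=> [[//|k] k2|N hN]; first exact: rp.
  have [M NM hM] := hp N hN; exists M => //.
  by rewrite /with0; case: M NM hM => //; rewrite addn1.
- case: hs => rs [N hN]; split=> [[//|k] k2|]; first exact: rs.
  by exists N; rewrite tailE.
- by rewrite NE /with0 => k kN; case: eqP => // _; exact: lo.
- by rewrite NE /with0 gtn_eqF.
- by rewrite NE /with0 => k kN; rewrite gtn_eqF ?hi // (leq_trans _ kN).
Qed.

Lemma zero_tail_primary_aux p N : (0 < N)%N -> reduced p ->
  (forall k, (N < k)%N -> p k = 0%N) -> primary_aux th p.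
Proof.
move=> N0 rp p0; split=> // K K0; exists (maxn K N).+1.
  by rewrite addn1 ltnS leq_maxl.
rewrite p0 ?ltnS ?leq_maxr // subSS subn0.
have := @th_ge2 (maxn K N); rewrite leq_max K0 => /(_ isT); lia.
Qed.

(** The partner lowers the last nonzero digit by one and continues with maximal digits, as 0.999...
    does for 1. *)
Lemma W1_of_primary p N : (0 < N)%N -> reduced p -> (0 < p N)%N ->
  (forall k, (N < k)%N -> p k = 0%N) ->
  W1 th (p, fun k => if (k < N)%N then p k else if k == N then (p N).-1
                     else (th (k - 1) - 1)%N).
Proof.
move=> N0 rp pN0 p0; set s := fun k => _.
have th_pred k : (2 <= k)%N -> (th (k - 1) - 1 < th (k - 1))%N.
  by move=> k2; have := @th_ge2 (k - 1)%N; rewrite subn_gt0 => /(_ k2); lia.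
have sN : secondary_tail th s N.
  by split=> // M; rewrite addn1 /s => NM; rewrite ltnNge ltnW // gtn_eqF.
(* An earlier start of the tail would force [(p N).-1] to be the maximal digit, so [p N] would not
   be reduced. *)
have sE : Nmin th s = N.
  apply: leastP => // K [K0 hK]; rewrite leqNgt; apply/negP => KN.
  have := hK N; rewrite addn1 => /(_ KN); rewrite /s ltnn eqxx.
  by have := rp N (leq_ltn_trans K0 KN); lia.
split; rewrite /= ?sE.
- exact: zero_tail_primary_aux N0 rp p0.
- split; last by exists N.
  move=> k k2; rewrite /s; case: ifP => _; first exact: rp.
  case: eqP => [kN|_]; last exact: th_pred.
  by rewrite kN in k2 *; have := rp N k2; lia.
- by move=> k kN; rewrite /s kN.
- by rewrite /s ltnn eqxx addn1 prednK.
- exact: p0.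
Qed.

(** The digit [t] placed alone at [K] is normalized by contractions below [K], which keep the sum at
    [K]. The last nonzero digit of the result is where the secondary partner branches off. *)
Lemma exists_W1 n t K : (0 < t)%N -> (0 < K)%N ->
  exists q, [/\ W1 th q, q.1 0%N = n & has_value q.1 (t%:R / (place K)%:R)].
Proof.
move=> t0 K0; pose f k := if k == 0%N then n else if k == K then t else 0%N.
have fK : psum f K = t%:R / (place K)%:R.
  case: K K0 @f => // K _ f; rewrite psumS /f eqxx /= -[RHS]add0r; congr (_ + _).
  rewrite (@eq_psum _ (fun=> 0%N)) ?(@psum_const _ 0) ?psum0 // => k hk.
  by do 2 (case: eqP => [?|_]; first lia).
have [s [happ hs rs]] := normalize K f.
set p := contract_seq th f s in rs.
have pK k : (K < k)%N -> p k = 0%N.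
  move=> Kk; rewrite /p (contract_seq_fix _ hs Kk) /f.
  by do 2 (case: eqP => [?|_]; first lia).
have rp : reduced p.
  move=> k k2; have [kK|/pK->] := leqP k K; first by apply: rs; rewrite k2.
  by have := @th_ge2 (k - 1)%N; lia.
have pv : psum p K = t%:R / (place K)%:R.
  by rewrite -fK; exact: psum_contract_seq_eq.
have ex : exists k, (0 < k)%N && (0 < p k)%N.
  apply: contrapT => /forallNP none.
  suff : psum p K = 0.
    by rewrite pv => /eqP; rewrite mulf_eq0 invr_eq0 (negbTE (placeR_neq0 _)) orbF
               pnatr_eq0 gtn_eqF.
  rewrite (@eq_psum _ (fun=> 0%N)) ?(@psum_const _ 0) ?psum0 // => k /andP[k0 _].
  by have := none k; rewrite k0 /= lt0n; case: eqP.
have ub k : (0 < k)%N && (0 < p k)%N -> (k <= K)%N.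
  by move=> /andP[_ pk0]; have [//|/pK pk] := leqP k K; rewrite pk in pk0.
case: (ex_maxnP ex ub) => N /andP[N0 pN0] maxN.
eexists; split; first apply: (W1_of_primary N0 rp pN0) => /=.
- move=> k Nk; apply/eqP; rewrite -leqn0 leqNgt; apply/negP => pk.
  have := maxN k; rewrite pk (leq_ltn_trans (leq0n _) Nk) => /(_ isT).
  by rewrite leqNgt Nk.
- by rewrite /= /p contract_seq0.
- by rewrite /= -pv; exact: has_value_finite.
Qed.

(* The sign is ignored at [x = 0], since [0] contains functions of both signs. *)
Definition signed_class (x : rat) (e : bool) : set (nat -> nat) :=
  [set f | has_value f x /\ (x != 0 -> odd (f 0%N) = e)].

Definition base_class (q : (nat -> nat) * (nat -> nat)) : set (nat -> nat) :=
  [set f | exists q', [/\ W1 th q', aux_equiv q.1 q'.1 & f = q'.1 \/ f = q'.2]].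

Lemma eq_sign f g : sign f = sign g <-> odd (f 0%N) = odd (g 0%N).
Proof. by rewrite /sign; case: odd; case: odd; split. Qed.

Lemma real_of_base_class q x : W1 th q -> has_value q.1 x ->
  real_of th (base_class q) = signed_class x (odd (q.1 0%N)).
Proof.
move=> Wq vq; have x0 : 0 < x.
  by have [y y0 [vy _]] := W1_has_value Wq; rewrite (has_value_uniq vq vy).
apply/seteqP; split=> f.
  move=> [h [q' [Wq' [q1 /eq_sign q0] hq']]] fh.
  have vq' : has_value q'.1 x by exact: eq_has_value vq.
  have [y _ [v1 v2]] := W1_has_value Wq'.
  rewrite (has_value_uniq v1 vq') in v2 => {y v1}.
  have vh : has_value h x by case: hq' => ->.
  split; first exact/(has_value_contracts _ fh).
  move=> _; rewrite q0 (contracts_to0 fh).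
  by case: hq' => ->; rewrite ?(W1_fst0 Wq').
move=> [vf /(_ (lt0r_neq0 x0)) f0].
have Wq' := W1_with0 (f 0%N) Wq; set q' := (_, _) in Wq'.
have eqq' : aux_equiv q.1 q'.1.
  by split=> [[]//|]; exact/eq_sign.
have vq' : has_value q'.1 x by apply: eq_has_value vq; case.
have [y _ [v1 v2]] := W1_has_value Wq'.
rewrite (has_value_uniq v1 vq') in v2 => {y v1}.
have [pq' sq' _ _ _] := Wq'.
(* If the supremum is attained, the strict upper bound of the primary expansion applies. Otherwise
   every sum of [f] is below [x], which supplies the strictness that the secondary expansion
   lacks. *)
have [[M fM]|nfx] := pselect (exists M, psum f M = x).
  exists q'.1; first by exists q'; split=> //; left.
  apply: contracts_toI => // [|N N0]; first exact: pq'.1.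
  exists (maxn N M); first exact: leq_maxl.
  have -> : psum f (maxn N M) = x.
    by apply/eqP; rewrite eq_le vf.1 -fM psum_le ?leq_maxr.
  by rewrite vq'.1 primary_aux_value_lt.
exists q'.2; first by exists q'; split=> //; right.
apply: contracts_toI => // [|N N0]; first exact: sq'.1.
have [M NM] := vf.2 _ (secondary_aux_value_gt N sq' v2).
exists (maxn N M); first exact: leq_maxl.
rewrite (le_trans (ltW NM)) ?psum_le ?leq_maxr //=.
apply: lt_le_trans (reduced_value_le sq'.1 v2 N0).
rewrite lt_neqAle vf.1 andbT; apply/eqP => e; apply: nfx.
by exists (maxn N M).
Qed.

(** * Disjointness of base elements and of real numbers, and the number zero *)

Lemma base_set_class q : W1 th q -> base_set th (base_class q).
Proof. by move=> Wq; left; exists q. Qed.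

Lemma base_set_reduced b h : base_set th b -> b h -> reduced h.
Proof.
move=> [[q Wq ->] [q' [[pq' sq' _ _ _] _ [->|->]]]|[g Wg ->] [[[rh _] _] _]] //.
- exact: pq'.1.
- exact: sq'.1.
Qed.

(** The branching position [Nmin] depends on the secondary component alone, which then dictates
    every primary digit. *)
Lemma W1_snd_inj q q' : W1 th q -> W1 th q' -> q.2 = q'.2 -> q.1 = q'.1.
Proof.
move=> [_ _ lo eqN hi] [_ _ lo' eqN' hi'] e; rewrite -e in lo' eqN' hi'.
apply/funext => k; have [kN|Nk|->] := ltngtP k (Nmin th q.2).
- by rewrite lo // lo'.
- by rewrite hi // hi'.
- by rewrite eqN eqN'.
Qed.

Lemma aux_equiv_sym f g : aux_equiv f g -> aux_equiv g f.
Proof. by move=> [e s]; split=> // k k0; rewrite e. Qed.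

Lemma aux_equiv_trans f g h : aux_equiv f g -> aux_equiv g h -> aux_equiv f h.
Proof. by move=> [e s] [e' s']; split=> [k k0|]; rewrite ?e ?e' ?s. Qed.

Lemma base_set_disjoint b b' h : base_set th b -> base_set th b' ->
  b h -> b' h -> b = b'.
Proof.
have classE q q' : aux_equiv q.1 q'.1 -> base_class q = base_class q'.
  move=> qq'; apply/seteqP; split=> f [r [Wr qr fr]]; exists r; split=> //.
    exact: aux_equiv_trans (aux_equiv_sym qq') qr.
  exact: aux_equiv_trans qq' qr.
move=> [[q Wq ->]|[g Wg ->]] [[q' Wq' ->]|[g' Wg' ->]].
- move=> [r [Wr qr hr]] [r' [Wr' qr' hr']].
  suff rr' : r.1 = r'.1.
    apply: classE; rewrite rr' in qr.
    exact: aux_equiv_trans qr (aux_equiv_sym qr').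
  have [pr sr _ _ _] := Wr; have [pr' sr' _ _ _] := Wr'.
  case: hr hr' => -> [] e //.
  + by rewrite e in pr; case: (primary_not_secondary pr sr').
  + by rewrite e in sr; case: (primary_not_secondary pr' sr).
  + exact: W1_snd_inj.
- by move=> [r [Wr _ hr]] [[_ nr] _]; case: nr; exists r.
- by move=> [[_ nr] _] [r [Wr _ hr]]; case: nr; exists r.
- move=> [_ gh] [_ gh']; apply/seteqP; split=> f [Wf gf]; split=> //.
    exact: aux_equiv_trans gh' (aux_equiv_trans (aux_equiv_sym gh) gf).
  exact: aux_equiv_trans gh (aux_equiv_trans (aux_equiv_sym gh') gf).
Qed.

(** A primary component of a pair has a positive digit at [Nmin], and a function that is primary
    cannot be a secondary component. *)
Lemma W2_zero f : (forall k, (0 < k)%N -> f k = 0%N) -> W2 th f.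
Proof.
move=> f0; have pf : primary_aux th f.
  apply: (@zero_tail_primary_aux _ 1) => // k hk; rewrite f0 ?(ltnW hk) //.
  by have := @th_ge2 (k - 1)%N; lia.
split=> // -[q [pq sq lo eqN hi] [fq|fq]].
  have [N0 _] := secondary_tail_Nmin sq.
  by move: eqN; rewrite -fq f0 // addn1.
by rewrite -fq in sq; exact: primary_not_secondary pf sq.
Qed.

Definition zero_class (f : nat -> nat) : set (nat -> nat) :=
  [set g | W2 th g /\ aux_equiv f g].

Lemma the_base_zero f : (forall k, (0 < k)%N -> f k = 0%N) ->
  the_member (base_set th) f = zero_class f.
Proof.
move=> f0; have Bf : base_set th (zero_class f).
  by right; exists f => //; exact: W2_zero.
have ff : zero_class f f by split=> //; exact: W2_zero.
by apply: the_memberE => // y By yf; apply: (base_set_disjoint By Bf yf ff).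
Qed.

Lemma b1E : b1 th = zero_class (fun=> 0%N).
Proof. exact: the_base_zero. Qed.

Lemma b2E : b2 th = zero_class (fun k => if k == 0%N then 1%N else 0%N).
Proof. by apply: the_base_zero; case. Qed.

Lemma zero_classP f g : (forall k, (0 < k)%N -> f k = 0%N) ->
  zero_class f g -> has_value g 0.
Proof. by move=> f0 [_ [e _]]; apply/has_value0P => k k0; rewrite -e // f0. Qed.

Lemma base_set_b12 b : b = b1 th \/ b = b2 th ->
  base_set th b /\ forall h, b h -> has_value h 0.
Proof.
have H f : (forall k, (0 < k)%N -> f k = 0%N) ->
    base_set th (zero_class f) /\ forall h, zero_class f h -> has_value h 0.
  move=> f0; split=> [|h]; last exact: zero_classP.
  by right; exists f => //; exact: W2_zero.
by case=> ->; rewrite ?b1E ?b2E; apply: H => // -[].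
Qed.

Lemma real_zeroE e : real_zero th = signed_class 0 e.
Proof.
apply/seteqP; split=> f.
  by case=> -[h bh fh]; split; rewrite ?eqxx //; apply/(has_value_contracts _ fh);
    apply: (base_set_b12 _).2 bh; [left|right].
move=> [/has_value0P f0 _]; have Wf := W2_zero f0.
(* Such an [f] is its own limit; odd values at 0 belong to [b2], even ones to [b1]. *)
case: (boolP (odd (f 0%N))) => sf; [right|left]; exists f;
  try exact: contracts_to_refl.
- by rewrite b2E; split=> //; split=> [[]//k|]; [rewrite f0|apply/eq_sign; rewrite sf].
- rewrite b1E; split=> //; split=> [[]//k|]; first by rewrite f0.
  by apply/eq_sign; rewrite (negbTE sf).
Qed.

(** Merging [b1] and [b2] is written as a function of the base element, so a real number is
    determined by the base element that one of its functions contracts into. *)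
Lemma real_numbers_mem z f : real_numbers th z -> z f ->
  exists b h, [/\ base_set th b, b h, contracts_to f h &
    z = if `[< b = b1 th \/ b = b2 th >] then real_zero th else real_of th b].
Proof.
move=> [[b [Bb nb1 nb2 ->]] [h bh fh]|-> [] [h bh fh]].
- by exists b, h; split=> //; case: asboolP => // -[].
- exists (b1 th), h; have [] := @base_set_b12 (b1 th); first by left.
  by split=> //; case: asboolP => // -[]; left.
- exists (b2 th), h; have [] := @base_set_b12 (b2 th); first by right.
  by split=> //; case: asboolP => // -[]; right.
Qed.

Lemma real_numbers_disjoint z z' f : real_numbers th z -> real_numbers th z' ->
  z f -> z' f -> z = z'.
Proof.
move=> Rz Rz' /(real_numbers_mem Rz)[b [h [Bb bh fh ->]]].
move=> /(real_numbers_mem Rz')[b' [h' [Bb' bh' fh' ->]]].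
have hh' : h = h'.
  by apply: (contracts_to_inj _ _ fh fh'); [exact: base_set_reduced bh|
                                           exact: base_set_reduced bh'].
by rewrite -hh' in bh'; rewrite (base_set_disjoint Bb Bb' bh bh').
Qed.

Lemma real_numbers_nonempty z : real_numbers th z -> exists f, z f.
Proof.
move=> [[b [Bb _ _ ->]]|->].
- have [h bh] : exists h, b h.
    case: Bb => [[q Wq ->]|[h Wh ->]]; last by exists h.
    by exists q.1, q; split=> //; left.
  by exists h, h => //; exact: contracts_to_refl.
- by exists (fun=> 0%N); rewrite (real_zeroE false); split; rewrite ?eqxx //;
    apply/has_value0P.
Qed.

(** * Arithmetic under Cantor's divisibility property *)

Hypothesis hcantor : cantor_divisibility th.

Lemma cantor_terminating (x : rat) : 0 <= x ->
  exists t K, (0 < K)%N /\ x = t%:R / (place K)%:R.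
Proof.
move=> x0; have [m hm] := hcantor (etrans (absz_gt0 _) (denq_neq0 x)).
(* Levels 0 and 1 both give the empty product, so the level may be assumed positive. *)
have mE : place (maxn m 1) = place m by case: m {hm} => // m; rewrite maxnC /maxn.
have [c hc] := dvdnP hm; rewrite -/(place m) -mE in hc.
exists (`|numq x| * c)%N, (maxn m 1); split; first by rewrite leq_max orbT.
have c0 : c%:R != 0 :> rat.
  by have := placeR_neq0 (maxn m 1); rewrite hc natrM mulf_eq0 negb_or => /andP[].
rewrite hc !natrM invfM mulrA mulfK // !natr_absz.
by rewrite (ger0_norm (_ : 0 <= numq x)) ?numq_ge0 // (gtr0_norm (denq_gt0 x)) divq_num_den.
Qed.

Lemma exists_W1_value n x : 0 < x ->
  exists q, [/\ W1 th q, q.1 0%N = n & has_value q.1 x].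
Proof.
move=> x0; have [t [K [K0 xE]]] := cantor_terminating (ltW x0).
rewrite xE; apply: exists_W1 => //; rewrite lt0n; apply: contraTneq x0 => t0.
by rewrite xE t0 mul0r ltxx.
Qed.

Lemma real_numbers_signed_class x e : 0 <= x -> real_numbers th (signed_class x e).
Proof.
rewrite le0r => /predU1P[->|x0]; first by right; rewrite (real_zeroE e).
(* The boolean [e], read as 0 or 1, serves as the value at 0 and gives the parity wanted. *)
have [q [Wq q0 vq]] := exists_W1_value e x0.
left; exists (base_class q).
have nz b : b = b1 th \/ b = b2 th -> base_class q <> b.
  move=> /base_set_b12[_ vb] bq; rewrite -bq in vb.
  have /vb /(has_value_uniq vq) xz : base_class q q.1 by exists q; split=> //; left.
  by rewrite xz ltxx in x0.
split; [exact: base_set_class|apply: nz; by left|apply: nz; by right|].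
by rewrite (real_of_base_class Wq vq) q0; case: e {q0}.
Qed.

Lemma signed_class_unique z x e f : 0 <= x -> real_numbers th z -> z f ->
  signed_class x e f -> z = signed_class x e.
Proof.
by move=> x0 Rz; apply: real_numbers_disjoint => //; exact: real_numbers_signed_class.
Qed.

Lemma signed_class_nonempty x e : 0 <= x -> exists f, signed_class x e f.
Proof. by move=> x0; apply/real_numbers_nonempty/real_numbers_signed_class. Qed.

Lemma secondary_in_signed_class x e : 0 < x ->
  exists h, secondary_aux th h /\ signed_class x e h.
Proof.
move=> x0; have [q [Wq q0 vq]] := exists_W1_value e x0.
exists q.2; split; first by case: Wq.
have [y _ [v1 v2]] := W1_has_value Wq.
rewrite (has_value_uniq v1 vq) in v2.
by split=> // _; rewrite -(W1_fst0 Wq) q0; case: e {q0}.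
Qed.

Lemma real_mul_signed_class x y e e' : 0 <= x -> 0 <= y ->
  real_mul th (signed_class x e) (signed_class y e') =
  signed_class (x * y) (e (+) e').
Proof.
move=> x0 y0; have H f g : signed_class x e f -> signed_class y e' g ->
    signed_class (x * y) (e (+) e') (sub_product th f g).
  move=> [vf sf] [vg sg]; split; first exact: has_value_sub_product.
  (* A nonzero product has nonzero factors, so both parities are known, and values at 0 add. *)
  by rewrite mulf_eq0 negb_or => /andP[/sf<- /sg<-]; rewrite -oddD.
apply: xget_unique => [|z [Rz hz]].
  by split=> //; apply: real_numbers_signed_class; exact: mulr_ge0.
have [f xf] := signed_class_nonempty e x0.
have [g yg] := signed_class_nonempty e' y0.
by apply: (signed_class_unique _ Rz (hz _ _ xf yg)); [exact: mulr_ge0|exact: H].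
Qed.

Lemma has_value_nat f m : f 1%N = m -> (forall k, (1 < k)%N -> f k = 0%N) ->
  has_value f m%:R.
Proof. by move=> f1 f0; rewrite -f1 -psum1; exact: has_value_finite. Qed.

Lemma real_oneE : real_one th = signed_class 1 false.
Proof.
set f := fun k : nat => if k == 1%N then 1%N else 0%N.
have cf : signed_class 1 false f.
  split=> //; apply: (@has_value_nat f 1) => // k k1.
  by rewrite /f gtn_eqF.
apply: the_memberE (cf) => [y Ry yf|]; last exact: real_numbers_signed_class.
exact: signed_class_unique yf cf.
Qed.

(** For uniqueness the candidate [z] is an arbitrary real number, not known to have a rational
    value. Multiplying by the one-digit representative [m] scales its partial sums exactly, so its
    value can be read off the product. *)
Lemma real_inv_signed_class m e : (0 < m)%N ->
  real_inv th (signed_class m%:R e) = signed_class m%:R^-1 e.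
Proof.
move=> m0; have mR0 : 0 < m%:R :> rat by rewrite ltr0n.
have mRV0 : 0 <= m%:R^-1 :> rat by rewrite invr_ge0.
apply: xget_unique => [|z [Rz]].
  split; first exact: real_numbers_signed_class.
  by rewrite real_mul_signed_class // mulfV ?lt0r_neq0 // addbb real_oneE.
(* If the product were undefined it would be the default [set0], but the class of 1 is nonempty. *)
rewrite real_oneE /real_mul; case: xgetP => [w _ [_ hw] w1|_ e0]; last first.
  by have [f] := signed_class_nonempty false (ler01 : 0 <= 1 :> rat); rewrite -e0.
have [g zg] := real_numbers_nonempty Rz.
pose f k := if k == 0%N then nat_of_bool e else if k == 1%N then m else 0%N.
have f0 k : (1 < k)%N -> f k = 0%N by case: k => // -[].
have cf : signed_class m%:R e f.
  by split=> [|_]; [exact: has_value_nat|rewrite /f oddb].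
have := hw _ _ cf zg; rewrite w1 => -[vfg sfg].
have pfg M : psum (sub_product th f g) M = m%:R * psum g M.
  exact: psum_sub_product_nat.
apply: (signed_class_unique mRV0 Rz zg); split=> [|_].
  split=> [M|y ym].
    by rewrite -[leRHS]mul1r ler_pdivlMr // mulrC -pfg; exact: vfg.1.
  rewrite -[ltRHS]mul1r ltr_pdivlMr // mulrC in ym.
  by have [M] := vfg.2 _ ym; rewrite pfg ltr_pM2l //; exists M.
have := sfg (oner_neq0 _); rewrite /sub_product eqxx oddD /f oddb.
by clear; case: e; case: odd.
Qed.

(** * Integers and rational numbers *)

Lemma integer_value a_p a_s x : primary_aux th a_p -> secondary_aux th a_s ->
  has_value a_p x -> has_value a_s x -> Psi a_p a_s = 1%N -> x = (a_p 1%N)%:R.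
Proof.
move=> pa sa vp vs psi.
have ne : a_p 1%N <> a_s 1%N.
  pose P := [set n | (0 < n)%N /\ a_p n <> a_s n]%classic.
  suff : P 1%N by case.
  have [[n Pn]|none] := pselect (exists n, P n).
    by rewrite -psi; exact: least_mem Pn.
  (* Without any differing position [least] would return its default 0, not 1. *)
  move: psi; rewrite /Psi /least; case: xgetP => // n _ [Pn _] _.
  by case: none; exists n.
have := primary_aux_value_lt pa vp (isT : 0 < 1)%N.
have := vp.1 1%N; have := secondary_aux_value_gt 1 sa vs.
have := reduced_value_le sa.1 vs (isT : 0 < 1)%N.
rewrite !psum1 place1 invr1 !natr1 => h1 h2 h3 h4.
have lo : (a_p 1 < (a_s 1).+2)%N by rewrite -(ltr_nat rat) -natr1; lra.
have hi : (a_s 1 < (a_p 1).+1)%N by rewrite -(ltr_nat rat) -natr1; lra.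
(* The value lies from [a_p 1] up to but excluding [a_p 1 + 1], and above [a_s 1] up to and
   including [a_s 1 + 1]. As the two digits differ, only consecutive ones fit, and [x] is the
   endpoint common to both ranges. *)
have e : a_p 1%N = (a_s 1).+1.
  by move: (a_p 1%N) (a_s 1%N) ne lo hi; clear; lia.
by move: h1 h2 h3 h4; rewrite e -natr1; lra.
Qed.

Lemma real_integerP a : real_integer th a <->
  exists m e, a = signed_class m%:R e.
Proof.
split=> [[Ra [->|[ap [as_ [[pa aap] [sa aas] psi]]]]]|[m [e ->]]].
- by exists 0%N, false; exact: real_zeroE.
- have [N hN] := sa.2; have vs := has_value_secondary hN.
  have vs0 := has_value_ge0 vs.
  have aE := signed_class_unique vs0 Ra aas (conj vs (fun=> erefl)).
  rewrite aE in aap.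
  rewrite (integer_value pa sa aap.1 vs psi) in aE.
  by exists (ap 1%N), (odd (as_ 0%N)).
- split; first by apply: real_numbers_signed_class; rewrite ler0n.
  case: m => [|m]; first by left; rewrite (real_zeroE e).
  (* The single digit [m.+1] at position 1 has a partner starting with [m], so the two differ at
     once. *)
  right; pose p k := if k == 0%N then nat_of_bool e else
                     if k == 1%N then m.+1 else 0%N.
  have p0 k : (1 < k)%N -> p k = 0%N by case: k => // -[].
  have rp : reduced p.
    by move=> k k2; rewrite p0 //; have := @th_ge2 (k - 1)%N; lia.
  have Wq := @W1_of_primary p 1 isT rp isT p0; set q := (_, _) in Wq.
  have [x _ [vp vs]] := W1_has_value Wq.
  have xE : x = m.+1%:R by apply: has_value_uniq vp _; exact: has_value_nat.
  exists q.1, q.2; have [pq sq _ _ _] := Wq.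
  do 2?[split=> //]; rewrite -?xE; do 2?[split=> //].
  + by move=> _; rewrite /= /p oddb.
  + by move=> _; rewrite /= /p oddb.
  + by apply: leastP => [|k []//]; split=> //=; rewrite /p /=; lia.
Qed.

Lemma rational_iff_secondary a : real_numbers th a ->
  real_rational th a <->
  (a = real_zero th \/ exists h, secondary_aux th h /\ a h).
Proof.
move=> Ra; split.
  move=> [_ [b [c [/real_integerP[n [e ->]] /real_integerP[m [e' ->]] c0 ->]]]].
  have m0 : (0 < m)%N.
    by rewrite lt0n; apply/eqP => m0; apply: c0; rewrite m0 (real_zeroE e').
  rewrite real_inv_signed_class // real_mul_signed_class ?invr_ge0 ?ler0n //.
  have [->|n0] := posnP n; first by left; rewrite mul0r -real_zeroE.
  right; apply: secondary_in_signed_class.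
  by rewrite divr_gt0 ?ltr0n.
move=> aE; split=> //.
have [x [e [x0 ->]]] : exists x e, 0 <= x /\ a = signed_class x e.
  case: aE => [->|[h [sh ah]]].
    by exists 0, false; split=> //; exact: real_zeroE.
  have [N hN] := sh.2; have vh := has_value_secondary hN.
  have x0 := has_value_ge0 vh; eexists _, _; split; first exact: x0.
  exact: signed_class_unique x0 Ra ah (conj vh (fun=> erefl)).
have [t [K [K0 xE]]] := cantor_terminating x0.
(* The fraction itself supplies the two integers; the numerator carries the sign. *)
exists (signed_class t%:R e), (signed_class (place K)%:R false); split.
- by apply/real_integerP; exists t, e.
- by apply/real_integerP; exists (place K), false.
- rewrite (real_zeroE false) => cE.
  have [f cf] := signed_class_nonempty false (ler0n rat (place K)).
  have := cf; rewrite cE => -[v0 _].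
  by have /eqP := has_value_uniq cf.1 v0; rewrite (negbTE (placeR_neq0 _)).
- rewrite real_inv_signed_class ?place_gt0 // real_mul_signed_class ?invr_ge0 ?ler0n //.
  by rewrite addbF xE.
Qed.

End Numeration.

Theorem theorem10p0p4 (th : nat -> nat) (hth : system_function th)
    (hcantor : cantor_divisibility th)
    (a : set (nat -> nat)) (ha : real_numbers th a) :
  real_rational th a <->
  (a = real_zero th \/ exists h : nat -> nat, secondary_aux th h /\ a h).
Proof. exact: rational_iff_secondary. Qed.
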